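(* Let $P$ be a rooted forest. Suppose an interval $[u,w]$ in $P^*$ does not contain a non-trivial disconnected subinterval. Then $[u,w]$ is dual CL-shellable.
   Context: A rooted forest is a poset $P$ that is a disjoint union of trees, each rooted at a unique bottom element; equivalently, letting $P_0$ denote $P$ with a bottom element $0$ adjoined, every element of $P_0$ except $0$ covers exactly one element (each element $x$ of $P_0$ has finite rank, the length of the chain from $0$ to $x$). $P^*$ is the set of finite words over the alphabet $P$, with generalized subword order: $u\le w$ if there is a subword $w(i_1)\cdots w(i_k)$ ($i_1<\dots<i_k$) of the same length as $u$ with $u(j)\le_P w(i_j)$ for all $1\le j\le k$. $|w|$ is the sum of the ranks in $P_0$ of the letters of $w$ (the rank of $w$ in $P^*$). $[u,w]=\{v:u\le v\le w\}$ and $(u,w)=\{v:u<v<w\}$; a subinterval of $[u,w]$ is $[u',w']$ with $u\le u'\le w'\le w$, of rank $|w'|-|u'|$. An interval $[u',w']$ is disconnected if the order complex of $(u',w')$ is disconnected, i.e. $(u',w')$ is the disjoint union of two nonempty subsets with no element of one comparable to an element of the other. A disconnected subinterval is non-trivial if it has rank at least $3$. CL-shellability. Let $Q$ be a finite bounded graded poset. A chain-edge labeling of $Q$ assigns to each pair (maximal chain $m$ of $Q$, covering relation of $m$) an element of a poset $\Lambda$, such that if two maximal chains coincide along their first $d$ covering relations from the bottom, then their labels coincide along these. For $x\le y$ in $Q$ and a maximal chain $r$ of $[\hat 0,x]$, the rooted interval $[x,y]_r$ is $[x,y]$ together with $r$; each maximal chain of $[x,y]$ then has a well-defined label sequence (read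 from bottom to top), obtained by preceding it by $r$. The labeling is a CL-labeling if in every rooted interval $[x,y]_r$ there is a unique maximal chain whose label sequence is (weakly) increasing, and its label sequence lexicographically precedes the label sequences of all other maximal chains of $[x,y]_r$. $Q$ is CL-shellable if it admits a CL-labeling, and dual CL-shellable if its order dual is CL-shellable (i.e. chains of $Q$ are labeled and read from top to bottom). *)

(* Defs.v *)
From HB Require Import structures.
From mathcomp Require Import all_boot all_order.
From mathcomp Require Import boolp classical_sets cardinality.

Set Implicit Arguments.
Unset Strict Implicit.
Unset Printing Implicit Defensive.

Import Order.TTheory.

Local Open Scope classical_set_scope.
Local Open Scope order_scope.

Section PosetNotions.
Context {disp : Order.disp_t} {T : porderType disp}.
Implicit Types (a b x y z : T) (c r t m : seq T).

(* A boolean, so that it can be used with [path]. *)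
Definition covers : rel T :=
  fun x y => `[< x < y /\ forall z, ~~ (x < z < y) >].

(* A maximal chain [x = x_0 <. x_1 <. ... <. x_n = y] of [x, y] is encoded by
   the sequence [:: x_1; ...; x_n], whose size is its length; its i-th covering
   relation (from i = 0) is the step x_i <. x_i.+1. *)
Definition maximal_chain x y : set (seq T) :=
  [set c | path covers x c /\ last x c = y].

Definition disconnected x y : Prop :=
  exists A B : set T,
    [/\ A !=set0, B !=set0, A `&` B = set0,
        A `|` B = [set z | x < z < y]
      & forall p q, A p -> B q -> p >< q].

Definition finite_bounded_graded a b : Prop :=
  [/\ a <= b, finite_set [set x | a <= x <= b]
    & forall m m', maximal_chain a b m -> maximal_chain a b m' ->
        size m = size m'].

Section Labelings.
Context {dispL : Order.disp_t} {L : porderType dispL}.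

(* [lam m i] is the label of the i-th covering relation of the maximal chain m;
   the values for other m or i are irrelevant. *)
Implicit Type lam : seq T -> nat -> L.

Definition chain_edge_labeling a b lam : Prop :=
  forall m m' (k : nat), maximal_chain a b m -> maximal_chain a b m' ->
    (k <= size m)%N -> (k <= size m')%N -> take k m = take k m' ->
    forall i, (i < k)%N -> lam m i = lam m' i.

(* The labels along c of the maximal chain r ++ c ++ t of [a, b], where r, c, t
   are maximal chains of [a, x], [x, y], [y, b].  For a chain-edge labeling they
   do not depend on t. *)
Definition label_seq lam r t c : seqlexi L :=
  [seq lam (r ++ c ++ t) i | i <- iota (size r) (size c)].

Definition CL_labeling a b lam : Prop :=
  chain_edge_labeling a b lam /\
  forall x y r t, x <= y ->
    maximal_chain a x r -> maximal_chain y b t ->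
    exists c,
      [/\ maximal_chain x y c,
          sorted <=%O (label_seq lam r t c : seq L),
          forall c', maximal_chain x y c' ->
            sorted <=%O (label_seq lam r t c' : seq L) -> c' = c
        & forall c', maximal_chain x y c' -> c' <> c ->
            label_seq lam r t c < label_seq lam r t c'].

End Labelings.

(* CL-shellability of the poset Q = [a, b]. *)
Definition CL_shellable a b : Prop :=
  finite_bounded_graded a b /\
  exists (dispL : Order.disp_t) (L : porderType dispL) (lam : seq T -> nat -> L),
    CL_labeling a b lam.

End PosetNotions.

Definition dual_CL_shellable (disp : Order.disp_t) (T : porderType disp)
    (a b : T) : Prop :=
  @CL_shellable _ (T^d)%type b a.

(* P_0: the poset P with a bottom element adjoined. *)
Definition adjoin_bottom (disp : Order.disp_t) (P : porderType disp) : Type :=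
  option P.

Fact adjoin_bottom_display (disp : Order.disp_t) : Order.disp_t.
Proof. exact: (Order.Disp tt tt). Qed.

Section AdjoinBottom.
Context {disp : Order.disp_t} {P : porderType disp}.
Implicit Types x y z : adjoin_bottom P.

HB.instance Definition _ := Choice.copy (adjoin_bottom P) (option P).

Definition le_adjoin_bottom x y : bool :=
  match x, y with
  | None, _ => true
  | Some _, None => false
  | Some p, Some q => p <= q
  end.

Fact le_adjoin_bottom_refl : reflexive le_adjoin_bottom.
Proof. by case=> [p|] /=. Qed.

Fact le_adjoin_bottom_anti : antisymmetric le_adjoin_bottom.
Proof. by case=> [p|] [q|] //= /le_anti ->. Qed.

Fact le_adjoin_bottom_trans : transitive le_adjoin_bottom.
Proof. by case=> [q|] [p|] [s|] //=; exact: le_trans. Qed.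

HB.instance Definition _ :=
  Order.Le_isPOrder.Build (adjoin_bottom_display disp) (adjoin_bottom P)
    le_adjoin_bottom_refl le_adjoin_bottom_anti le_adjoin_bottom_trans.

Fact le_adjoin_bottom_None x : (None : adjoin_bottom P) <= x.
Proof. by []. Qed.

HB.instance Definition _ :=
  Order.hasBottom.Build (adjoin_bottom_display disp) (adjoin_bottom P)
    le_adjoin_bottom_None.

End AdjoinBottom.

Definition finite_rank (disp : Order.disp_t) (T : bPOrderType disp) (x : T) :
    Prop :=
  exists n : nat,
    forall c : seq T, path <%O \bot c -> last \bot c = x -> (size c <= n)%N.

(* In a rooted forest all the maximal chains of [\bot, x] are equal; the value 0
   is a junk default for elements without such a chain. *)
Definition rank (disp : Order.disp_t) (T : bPOrderType disp) (x : T) : nat :=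
  xget 0%N (size @` maximal_chain \bot x).

Definition rooted_forest (disp : Order.disp_t) (P : porderType disp) : Prop :=
  (forall x : adjoin_bottom P, finite_rank x) /\
  (forall x : adjoin_bottom P, x <> \bot -> exists! y, covers y x).

(* P^* with generalized subword order. *)
Definition words (disp : Order.disp_t) (P : porderType disp) : Type := seq P.

Fact words_display (disp : Order.disp_t) : Order.disp_t.
Proof. exact: (Order.Disp tt tt). Qed.

Section Words.
Context {disp : Order.disp_t} {P : porderType disp}.
Implicit Types u v w : words P.

HB.instance Definition _ := Choice.copy (words P) (seq P).

(* The bitmask m selects the positions i_1 < ... < i_k; [all2] also forces the
   selected subword to have the same length as u. *)
Definition le_words u w : bool :=
  [exists m : (size w).-tuple bool, all2 <=%O u (mask m w)].

Lemma le_wordsP u w :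
  reflect (exists2 v : seq P, subseq v w & all2 <=%O u v) (le_words u w).
Proof.
apply: (iffP existsP) => [[m um]|[v /subseqP[m sm ->] uv]].
  by exists (mask m w) => //; apply: mask_subseq.
by exists (tcast sm (in_tuple m)); rewrite val_tcast.
Qed.

Let all2_refl : reflexive (all2 (<=%O : rel P)).
Proof. by elim=> //= x s ->; rewrite lexx. Qed.

Let all2_trans : transitive (all2 (<=%O : rel P)).
Proof.
elim=> [|y s IH] [|x u] [|z w] //= /andP[xy us] /andP[yz sw].
by rewrite (le_trans xy yz) IH.
Qed.

Let all2_anti : antisymmetric (all2 (<=%O : rel P)).
Proof.
elim=> [|x s IH] [|y u] //= /andP[/andP[xy su] /andP[yx us]].
by rewrite (IH u) ?su ?us // (@le_anti _ _ x y) ?xy ?yx.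
Qed.

Let all2_mask m (u v : seq P) :
  all2 <=%O u v -> all2 <=%O (mask m u) (mask m v).
Proof.
elim: u v m => [|x u IH] [|y v] [|b m] //= /andP[xy uv].
by case: b => /=; rewrite ?xy IH.
Qed.

Let all2_size (u v : seq P) : all2 <=%O u v -> size u = size v.
Proof. by rewrite all2E => /andP[/eqP]. Qed.

Fact le_words_refl : reflexive le_words.
Proof. by move=> u; apply/le_wordsP; exists u. Qed.

Fact le_words_trans : transitive le_words.
Proof.
move=> v u w /le_wordsP[_ /subseqP[m _ ->] uv'] /le_wordsP[w' sw vw'].
apply/le_wordsP; exists (mask m w').
  exact: subseq_trans (mask_subseq m w') sw.
exact: all2_trans uv' (all2_mask m vw').
Qed.

Fact le_words_anti : antisymmetric le_words.
Proof.
move=> u w /andP[/le_wordsP[w' sw uw'] /le_wordsP[u' su wu']].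
have/eqP Ew : w' == w.
  rewrite -(size_subseq_leqif sw).2 eqn_leq size_subseq //=.
  by rewrite -(all2_size uw') (all2_size wu') size_subseq.
have/eqP Eu : u' == u.
  rewrite -(size_subseq_leqif su).2 eqn_leq size_subseq //=.
  by rewrite -(all2_size wu') (all2_size uw') Ew.
by apply: all2_anti; rewrite -[X in all2 _ u X]Ew uw' -[X in all2 _ _ X]Eu.
Qed.

HB.instance Definition _ :=
  Order.Le_isPOrder.Build (words_display disp) (words P)
    le_words_refl le_words_anti le_words_trans.

Definition word_rank w : nat :=
  (\sum_(p <- (w : seq P)) rank (Some p : adjoin_bottom P))%N.

End Words.

(* Main.v *)
Require Import Defs.
From mathcomp Require Import all_boot all_order.
From mathcomp Require Import boolp classical_sets cardinality zify.

Set Implicit Arguments.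
Unset Strict Implicit.
Unset Printing Implicit Defensive.

Import Order.TTheory.

Local Open Scope order_scope.

(** The label of a step down records which position of [w] it changes.  Going
    down a chain from [w], a word is carried along as an expansion of length
    [size w]: a sequence of letters of [P] with a bottom element adjoined, below
    [w] position by position, where the bottom stands for an erased letter.  In a
    rooted forest a lower cover replaces one letter by its parent, and different
    positions give different words except in a run of equal minimal letters, where
    the leftmost position is chosen ([covers_strip], [pos]).  If the labels were
    the positions alone, then an increasing chain would treat the positions of [w]
    from left to right, and the expansion reached at the end would determine it.

    Which expansions [e] of the target [y] below the current expansion [h] can be
    reached in this way?  One of them always should be the rightmost embedding of
    [y] in [h], characterized locally by the fact that no letter can slide into
    the next gap to its right ([greedy]).  Positions alone allow others: from
    [p p] with [p] of rank 2, both copies of [p] can be removed in increasing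
    order.  Therefore position [i] has two labels, [i.*2.+1] in general and the
    smaller [i.*2] when the letter at [i] is erased while the preceding letter [p]
    lies below [w] at [i], so that [p] could slide to [i].  If the letter at [i]
    has been lowered before in the same increasing chain, this smaller label is a
    descent; so increasing chains end at the rightmost embedding, and are unique
    ([increasing_greedy], [increasing_uniq]).  They are lexicographically first,
    since the rightmost embedding keeps the longest possible prefix of [h]
    intact ([greedy_prefix], [increasing_first]).

    Conversely, lowering [h] to its rightmost embedding from left to right gives
    an increasing chain unless the smaller label is met at a position which has
    been lowered before ([increasing_exists]).  Then the preceding letter [p] has
    rank at least 3, and the interval contains words [v1 p v2] and [v1 p p v2].
    This is excluded, because the interval between these two words is
    disconnected ([disconnected_double]) and has rank [rank p]. *)

(** * Rooted forests *)

Lemma coversP (disp : Order.disp_t) (T : porderType disp) (x y : T) :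
  covers x y <-> x < y /\ forall z, ~~ (x < z < y).
Proof. by split=> [/asboolP|h]; [|apply/asboolP]. Qed.

Section Forest.
Context {disp : Order.disp_t} {P : porderType disp}.
Hypothesis forestP : rooted_forest P.
Local Notation Q := (adjoin_bottom P).
Implicit Types x y z : Q.

(** Otherwise the chains from [z] to [x] could be refined without bound. *)
Lemma lt_le_covers x z : z < x -> exists2 y, z <= y & covers y x.
Proof.
have [n nP] := forestP.1 x.
have {nP}: forall c, path <%O z c -> last z c = x -> (size c <= n)%N.
  move=> c zc cx; have [z0|z0] := eqVneq z \bot.
    by apply: nP; rewrite -z0.
  apply: (@leq_trans (size (z :: c))) => //; apply: nP => //=.
  by rewrite zc andbT lt0x.
elim: n z => [|n IH] z nP zx.
  by have := nP [:: x]; rewrite /= zx => /(_ isT erefl).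
have [zx'|] := boolP (covers z x); first by exists z.
move=> /negP nzx; have [y /andP[zy yx]]: exists y, z < y < x.
  apply/not_existsP => h; apply: nzx; apply/coversP.
  by split=> // y; apply/negP/h.
have [c yc cx|y' yy' cy'] := IH y _ yx.
  by apply: (nP (y :: c)); rewrite /= ?zy.
by exists y' => //; apply: le_trans yy'; apply: ltW.
Qed.

Fact parent_exists x : exists y, if x == None then y = None else covers y x.
Proof.
case: eqP => [_|x0]; first by exists None.
by have [y [yx _]] := forestP.2 x x0; exists y.
Qed.

Definition parent x : Q := projT1 (cid (parent_exists x)).

Lemma parent0 : parent None = None.
Proof. by rewrite /parent; case: cid. Qed.

Lemma covers_parent x : x <> None -> covers (parent x) x.
Proof. by rewrite /parent; case: cid => y /=; case: eqP. Qed.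

Lemma lt_parent x : x <> None -> parent x < x.
Proof. by move=> /covers_parent/coversP[]. Qed.

Lemma covers_eq x y : covers y x -> y = parent x.
Proof.
move=> yx; have x0 : x <> None.
  by move=> x0; case/coversP: yx; rewrite x0 ltx0.
have [y' [_ uniq_y']] := forestP.2 x x0.
by rewrite -(uniq_y' _ yx) -(uniq_y' _ (covers_parent x0)).
Qed.

Lemma le_parent x z : z < x -> z <= parent x.
Proof. by move=> /lt_le_covers[y zy /covers_eq <-]. Qed.

Lemma parent_le x : parent x <= x.
Proof.
by case: (eqVneq x None) => [->|/eqP/lt_parent/ltW]; rewrite ?parent0.
Qed.

(** Induction along the unique chain from the bottom. *)
Lemma parent_ind (K : Q -> Prop) :
  K None -> (forall x, x <> None -> K (parent x) -> K x) -> forall x, K x.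
Proof.
move=> K0 KS x; have [n nP] := forestP.1 x.
elim: n x nP => [|n IH] x nP.
  case: (eqVneq x None) => [->//|/eqP x0].
  have := nP [:: x]; rewrite /= andbT lt0x => h.
  by have := h (introN eqP x0) erefl.
case: (eqVneq x None) => [->//|/eqP x0].
apply: KS => //; apply: IH => c pc cx.
have := nP (rcons c x); rewrite rcons_path last_rcons size_rcons pc cx.
by move/(_ (lt_parent x0) erefl).
Qed.

Lemma maximal_chain_parent x : x <> None ->
  maximal_chain \bot x = ((rcons^~ x) @` maximal_chain \bot (parent x))%classic.
Proof.
move=> x0; apply/seteqP; split=> [c|_ [c [cp cl] <-]]; last first.
  by split; rewrite ?last_rcons // rcons_path cp cl covers_parent.
case: (lastP c) => [[_ /esym] //|{}c y [/= + yx]].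
rewrite last_rcons in yx; rewrite {}yx rcons_path => /andP[cp /covers_eq cx].
by exists c.
Qed.

Lemma maximal_chain_bot : maximal_chain \bot (None : Q) = [set [::]]%classic.
Proof.
apply/seteqP; split=> [c|_ ->]; last by split.
case: (lastP c) => [//|{}c y [/= + yx]].
by rewrite last_rcons in yx; rewrite {}yx rcons_path => /andP[_ /coversP[]]; rewrite ltx0.
Qed.

Lemma rank0 : rank (None : Q) = 0%N.
Proof.
by rewrite /rank maximal_chain_bot image_set1; apply: xget_unique => // y ->.
Qed.

Lemma rankS x : x <> None -> rank x = (rank (parent x)).+1.
Proof.
move=> x0; have [c] : exists c, maximal_chain \bot (parent x) = [set c]%classic.
  elim/parent_ind: (parent x) => [|y y0 [c cE]].
    by exists [::]; rewrite maximal_chain_bot.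
  by exists (rcons c y); rewrite maximal_chain_parent // cE image_set1.
have rk y b : maximal_chain \bot y = [set b]%classic -> rank y = size b.
  by move=> bE; rewrite /rank bE image_set1; apply: xget_unique => // ? ->.
move=> cE; rewrite (rk _ _ cE) -(size_rcons c x); apply: rk.
by rewrite maximal_chain_parent // cE image_set1.
Qed.

Lemma le_rank x y : x <= y -> (rank x <= rank y ?= iff (x == y))%N.
Proof.
elim/parent_ind: y => [|y y0 IH].
  by rewrite lex0 => /eqP->; split; rewrite ?rank0 ?eqxx.
rewrite le_eqVlt => /predU1P[->|xy]; first by split; rewrite ?eqxx.
have := IH (le_parent xy); rewrite (rankS y0) => -[h _].
split; first exact: leq_trans h (leqnSn _).
by rewrite (lt_eqF xy) ltn_eqF.
Qed.

Lemma le_down_total x y z : y <= x -> z <= x -> (y <= z) || (z <= y).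
Proof.
elim/parent_ind: x => [|x x0 IH]; first by rewrite !lex0 => /eqP-> /eqP->.
rewrite le_eqVlt => /predU1P[->->|yx]; first by rewrite orbT.
rewrite le_eqVlt => /predU1P[->|zx]; first by rewrite (ltW yx).
by apply: IH; apply: le_parent.
Qed.

End Forest.

Arguments parent_ind {disp P} forestP K.

(** * Expansions of words *)

Section Expansions.
Context {disp : Order.disp_t} {P : porderType disp}.
Hypothesis forestP : rooted_forest P.
Local Notation Q := (adjoin_bottom P).
Local Notation parent := (parent forestP).
Implicit Types (x y z u v w : words P) (d e h W : seq Q) (i j k : nat).

Local Notation "e @ i" := (nth (None : Q) e i) (at level 10, format "e @ i").
Local Notation "e <<= h" := (all2 <=%O (e : seq Q) (h : seq Q)) (at level 70).

Definition strip (e : seq Q) : words P := pmap id e.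

Lemma strip_cat e h : strip (e ++ h) = strip e ++ strip h.
Proof. exact: pmap_cat. Qed.

Lemma strip_map (w : words P) : strip (map Some w) = w.
Proof. by elim: w => //= p w IH; rewrite /strip /= -/(strip _) IH. Qed.

Lemma pleP e h :
  reflect (size e = size h /\ forall i, e@i <= h@i) (e <<= h).
Proof.
apply: (iffP idP) => [|[]].
  elim: e h => [|a e IH] [|b h] //=.
  by move=> /andP[ab /IH[se eh]]; rewrite /= se; split=> // -[|i] //=.
elim: e h => [|a e IH] [|b h] //= /eqP + le; rewrite eqSS => /eqP eh.
rewrite (le 0%N) IH // => i; exact: (le i.+1).
Qed.

Lemma ple_refl e : e <<= e.
Proof. by apply/pleP; split. Qed.

Lemma ple_trans h e d : e <<= h -> h <<= d -> e <<= d.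
Proof.
move=> /pleP[se eh] /pleP[sh hk]; apply/pleP; split; first by rewrite se.
by move=> i; apply: le_trans (hk i).
Qed.

(** Generalized subword order is the componentwise order on expansions. *)
Lemma le_words_strip v h :
  v <= strip h <-> exists2 e, e <<= h & strip e = v.
Proof.
split=> [/le_wordsP[s]|[e eh <-]].
  elim: h v s => [|[p|] h IH] v s /=.
  - by case: s => // _; case: v => // _; exists [::].
  - rewrite /strip /= -/(strip _); case: s => [|q s] /=.
      move=> _; case: v => // _.
      by have [e eh ee] := IH [::] [::] (sub0seq _) isT; exists (None :: e).
    case: eqP => [->|_] + /[dup] qv.
      case: v qv => [|a v] //= _ sh /andP[ap vs]; have [e eh <-] := IH _ _ sh vs.
      by exists (Some a :: e) => //=; rewrite eh andbT.
    move=> sh vs; have [e eh <-] := IH _ _ sh vs.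
    by exists (None :: e).
  - move=> sh vs; have [e eh <-] := IH _ _ sh vs.
    by exists (None :: e).
apply/le_wordsP; elim: e h eh => [|a e IH] [|b h] //=; first by exists [::].
move=> /andP[ab /IH[s sh es]]; case: b a ab => [p|] [a|] //= ap; last by exists s.
- exists (p :: s); first by rewrite /strip /= eqxx.
  by rewrite /strip /=; apply/andP.
- by exists s => //; exact: (subseq_trans sh (subseq_cons _ p)).
Qed.

Lemma strip_le e h : e <<= h -> strip e <= strip h.
Proof. by move=> eh; apply/le_words_strip; exists e. Qed.

Definition erank e : nat := (\sum_(q <- e) rank q)%N.

Lemma erank_strip e : word_rank (strip e) = erank e.
Proof.
rewrite /word_rank /erank /strip; elim: e => [|[p|] e IH] /=.
- by rewrite !big_nil.
- by rewrite !big_cons IH.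
- by rewrite big_cons IH rank0.
Qed.

Lemma ple_erank e h : e <<= h -> (erank e <= erank h ?= iff (e == h))%N.
Proof.
rewrite /erank; elim: e h => [|a e IH] [|b h] //=.
  by move=> _; apply/leqif_refl.
move=> /andP[ab /IH eh]; rewrite !big_cons eqseq_cons.
exact: leqif_add (le_rank forestP ab) eh.
Qed.

Lemma ple_strip_eq e h : e <<= h -> strip e = strip h -> e = h.
Proof.
by move=> /ple_erank eh seh; apply/eqP; rewrite -eh -!erank_strip seh.
Qed.

Lemma lt_word_rank x y : x < y -> (word_rank x < word_rank y)%N.
Proof.
rewrite lt_neqAle -(strip_map y) => /andP[xy /le_words_strip[e ey ex]].
move: xy; rewrite -ex !erank_strip ltn_neqAle !(ple_erank ey) andbT.
by apply: contraNN => /eqP->.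
Qed.

Definition red e i : seq Q := set_nth None e i (parent (e@i)).

Lemma nth_red e i j : (red e i)@j = if j == i then parent (e@i) else e@j.
Proof. by rewrite /red nth_set_nth. Qed.

Lemma size_red e i : (i < size e)%N -> size (red e i) = size e.
Proof. by move=> ie; rewrite /red size_set_nth; apply/maxn_idPr. Qed.

Lemma redE e i : (i < size e)%N ->
  red e i = take i e ++ parent (e@i) :: drop i.+1 e.
Proof. by move=> ie; rewrite /red set_nthE ie. Qed.

Lemma splitE e i : (i < size e)%N -> e = take i e ++ e@i :: drop i.+1 e.
Proof. by move=> ie; rewrite -drop_nth // cat_take_drop. Qed.

Lemma ltn_nth e i : e@i <> None -> (i < size e)%N.
Proof.
by move=> e0; rewrite ltnNge; apply/negP => ie; apply: e0; rewrite nth_default.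
Qed.

Lemma red_ple e i : (i < size e)%N -> red e i <<= e.
Proof.
move=> ie; apply/pleP; rewrite size_red //; split=> // j.
by rewrite nth_red; case: eqP => [->|]; rewrite ?parent_le.
Qed.

Lemma ple_red e h i : e <<= h -> e@i <> h@i -> e <<= red h i.
Proof.
move=> /pleP[s le] ne.
have hi : h@i <> None by move=> h0; apply: ne; move: (le i); rewrite h0 lex0 => /eqP.
apply/pleP; split; rewrite ?size_red ?ltn_nth // => j.
rewrite nth_red; case: eqP => // ->; apply: le_parent.
by rewrite lt_neqAle le andbT; apply/eqP.
Qed.

Lemma erank_red e i : e@i <> None -> erank e = (erank (red e i)).+1.
Proof.
move=> e0; have ie := ltn_nth e0; rewrite redE // [X in erank X = _](splitE ie).
by rewrite /erank !big_cat /= !big_cons (rankS forestP e0) addSn addnS.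
Qed.

Lemma covers_red e i : e@i <> None -> covers (strip (red e i)) (strip e).
Proof.
move=> e0; have r1 := erank_red e0; apply/coversP; split.
  rewrite lt_neqAle strip_le ?red_ple ?ltn_nth // andbT.
  by apply/eqP => eq; move: r1; rewrite -!erank_strip eq => /n_Sn.
move=> z; apply/negP => /andP[/lt_word_rank + /lt_word_rank].
by rewrite !erank_strip r1 ltnS => /leq_trans h /h; rewrite ltnn.
Qed.

Lemma ple_neq e h : e <<= h -> e <> h -> exists i, e@i <> h@i.
Proof.
move=> /pleP[s _] ne; apply/not_existsP => eq; apply: ne.
by apply: (@eq_from_nth _ None) => // i _; apply: contrapT; apply: eq.
Qed.

Lemma lt_strip_red h v : v < strip h ->
  exists2 i, h@i <> None & v <= strip (red h i).
Proof.
rewrite lt_neqAle => /andP[ne /le_words_strip[e eh ev]].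
have [|i nei] := ple_neq eh; first by move=> eqeh; rewrite -ev eqeh eqxx in ne.
exists i; last by rewrite -ev strip_le ?ple_red.
move=> h0; apply: nei; move/pleP: eh => [_ /(_ i)].
by rewrite h0 lex0 => /eqP.
Qed.

(** A smaller word has an expansion which is strictly smaller at some position, so
    it lies below the word lowered there. *)
Lemma covers_strip z h : covers z (strip h) ->
  exists2 i, h@i <> None & z = strip (red h i).
Proof.
move=> /coversP[zh nb]; have [i hi zi] := lt_strip_red zh; exists i => //.
apply/eqP; have := nb (strip (red h i)).
have /coversP[-> _] := covers_red hi.
by rewrite andbT lt_neqAle zi andbT negbK.
Qed.

Lemma covers_word_rank z x : covers z x -> word_rank x = (word_rank z).+1.
Proof.
rewrite -(strip_map x) => /covers_strip[i hi ->].
by rewrite !erank_strip; apply: erank_red.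
Qed.

Definition down (q : Q) : seq Q := traject parent q (rank q).+1.

Lemma mem_down q r : r <= q -> r \in down q.
Proof.
rewrite /down; elim/(parent_ind forestP): q => [|q q0 IH].
  by rewrite lex0 => /eqP->; rewrite mem_head.
rewrite le_eqVlt => /predU1P[->|/(le_parent forestP)/IH]; first exact: mem_head.
by move=> rq; rewrite (rankS forestP q0) trajectS inE rq orbT.
Qed.

Fixpoint downs h : seq (seq Q) :=
  if h is q :: h' then [seq a :: e | a <- down q, e <- downs h'] else [:: [::]].

Lemma mem_downs e h : e <<= h -> e \in downs h.
Proof.
elim: e h => [|a e IH] [|b h] // /andP[/mem_down ab /IH eh].
by apply/allpairsP; exists (a, e).
Qed.

Lemma finite_below w : finite_set [set x : words P | x <= w]%classic.
Proof.
apply: (@sub_finite_set _ _ [set` map strip (downs (map Some w))]%classic);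
  last exact: finite_seq.
move=> x /=; rewrite -{1}(strip_map w) => /le_words_strip[e ew <-].
by apply: map_f; apply: mem_downs.
Qed.


(** * Rightmost embeddings *)

Definition prev e i : Q := last None (map Some (strip (take i e))).

(** An expansion [e] below [h] is the rightmost embedding of its word in [h] when
    no letter can be moved into a gap of [e] to its right. *)
Definition greedy e h : Prop :=
  forall i, e@i = None -> prev e i <> None -> ~~ (prev e i <= h@i).

Lemma strip_take e i : strip (take i e) = take (size (strip (take i e))) (strip e).
Proof.
by rewrite -[X in _ = take _ (strip X)](cat_take_drop i e) strip_cat take_size_cat.
Qed.

Lemma strip_takeS e i : (i < size e)%N ->
  strip (take i.+1 e) = strip (take i e) ++ strip [:: e@i].
Proof. by move=> ie; rewrite (take_nth None) // -cats1 strip_cat. Qed.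

Lemma size_strip_le e h : e <<= h -> (size (strip e) <= size (strip h))%N.
Proof.
move=> /strip_le/le_wordsP[v vh]; rewrite all2E => /andP[/eqP-> _].
exact: size_subseq.
Qed.

Lemma ple_take e h i : e <<= h -> take i e <<= take i h.
Proof. by elim: e h i => [|a e IH] [|b h] [|i] //= /andP[-> /IH->]. Qed.

(** Going from right to left, the count for [e] could first exceed the count for [d]
    only where [d] has a letter and [e] a gap.  Then that letter is also the one
    which precedes the gap in [e], and it could slide there. *)
Lemma greedy_count e d h : size e = size h -> greedy e h -> d <<= h ->
  strip d = strip e ->
  forall i, (size (strip (take i e)) <= size (strip (take i d)))%N.
Proof.
move=> se ge /pleP[sd dh] dee i.
have [ih|hi] := leqP i (size h); last first.
  by rewrite !take_oversize ?dee // ?se ?sd ltnW.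
rewrite -(subKn ih); elim: (size h - i)%N (leq_subr i (size h)) => [|n IH] nh.
  by rewrite subn0 !take_oversize ?dee ?se ?sd.
set j := (size h - n.+1)%N; have jh : (j < size h)%N by rewrite /j; lia.
have := IH (ltnW nh); have -> : (size h - n)%N = j.+1 by rewrite /j; lia.
have dej : size (strip (take j e)) = size (strip (take j.+1 d)) ->
    strip (take j e) = strip (take j.+1 d).
  by move=> eqs; rewrite strip_take eqs -dee -strip_take.
move: dej; rewrite !strip_takeS ?se ?sd // !size_cat.
case ej: (e@j) => [p|]; case dj: (d@j) => [q|] /= dej; [lia|lia| |lia].
rewrite addn0 addn1 leq_eqVlt => /predU1P[eqs|]; last by rewrite ltnS.
have pe : prev e j = Some q by rewrite /prev dej ?addn1 // map_cat last_cat.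
by have := ge j ej; rewrite pe -dj dh => /(_ _)/negP; rewrite dj; case.
Qed.

(** The rightmost embedding leaves as much as possible at the left: a prefix of
    [h] which it keeps intact is kept intact by all embeddings. *)
Lemma greedy_prefix e d h i : e <<= h -> greedy e h -> d <<= h ->
  strip d = strip e -> (forall j, (j < i)%N -> e@j = h@j) ->
  forall j, (j < i)%N -> d@j = h@j.
Proof.
move=> eh ge dh de agree j ji; have [se _] := pleP _ _ eh.
have tak : take i e = take i h.
  apply: (@eq_from_nth _ None); rewrite ?size_take ?se // => k ki.
  have ki' : (k < i)%N by move: ki; case: ifP; lia.
  by rewrite !nth_take // agree.
have cnt := greedy_count se ge dh de i.
have cnt' := size_strip_le (ple_take i dh).
suff : take i d = take i h.
  by move=> td; rewrite -(nth_take None ji d) td nth_take.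
apply: ple_strip_eq (ple_take i dh) _; rewrite -tak strip_take (strip_take e) de.
by congr take; apply/eqP; rewrite eqn_leq cnt andbT tak.
Qed.

Lemma greedy_uniq e d h : e <<= h -> greedy e h -> d <<= h -> greedy d h ->
  strip d = strip e -> d = e.
Proof.
move=> eh ge dh gd de.
have [se _] := pleP _ _ eh; have [sd _] := pleP _ _ dh.
have cnt i : strip (take i d) = strip (take i e).
  rewrite strip_take (strip_take e) de; congr take; apply/eqP; rewrite eqn_leq.
  by rewrite (greedy_count sd gd eh (esym de)) (greedy_count se ge dh de).
apply: (@eq_from_nth _ None); first by rewrite sd.
move=> i id; have := cnt i.+1; rewrite !strip_takeS -?sd ?se -?sd // cnt.
move/eqP; rewrite eqseq_cat // eqxx /=.
by case: (e@i) (d@i) => [p|] [q|] //= /eqP[->].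
Qed.

Lemma strip_rcons e a : strip (rcons e a) = strip e ++ strip [:: a].
Proof. by rewrite -cats1 strip_cat. Qed.

Lemma ple_rcons e h a b : (rcons e a <<= rcons h b) = (e <<= h) && (a <= b).
Proof.
elim: e h => [|x e IH] [|y h] /=; rewrite ?andbT ?andbF //.
- by case: h => [|??] /=; rewrite andbF.
- by case: e {IH} => [|??] /=; rewrite andbF.
- by rewrite IH andbA.
Qed.

Lemma prev_rcons e a i : (i <= size e)%N -> prev (rcons e a) i = prev e i.
Proof.
move=> ie; rewrite /prev -cats1 take_cat; case: ltnP => // ei.
by rewrite (anti_leq (introT andP (conj ie ei))) subnn take0 cats0 take_size.
Qed.

Lemma greedy_rcons e h a b : size e = size h -> greedy e h ->
  (a = None -> prev e (size e) <> None -> ~~ (prev e (size e) <= b)) ->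
  greedy (rcons e a) (rcons h b).
Proof.
move=> se ge la i; rewrite !nth_rcons -se.
case: ltngtP => [ie|ie|->].
- by rewrite prev_rcons 1?ltnW //; apply: ge.
- by move=> _; case: prev.
- by rewrite prev_rcons.
Qed.

(** Place the last letter of the word as far right as possible, then recurse on
    the rest. *)
Lemma greedy_exists d h : d <<= h ->
  exists e, [/\ e <<= h, greedy e h & strip e = strip d].
Proof.
elim/last_ind: h d => [|h b IH] d; case/lastP: d => [|d a].
- by exists [::]; split=> // i; rewrite /prev.
- by case: d.
- by case: h {IH}.
rewrite ple_rcons strip_rcons => /andP[/IH[e [eh ge <-{d}]] ab].
have [se _] := pleP _ _ eh.
case: a ab => [p|] ab.
  exists (rcons e (Some p)); rewrite ple_rcons eh ab strip_rcons; split=> //.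
  exact: greedy_rcons.
have [|mv] := boolP ((prev e (size e) != None) && (prev e (size e) <= b)); last first.
  exists (rcons e None); rewrite ple_rcons eh ab strip_rcons; split=> //.
  apply: greedy_rcons => // _ /eqP p0; move: mv.
  by rewrite p0.
(* The last letter [c] of the word slides to the last position. *)
rewrite cats0 /prev take_size; case/lastP ey: (strip e) => [//|y c].
rewrite map_rcons last_rcons => /= cb.
have /le_words_strip[d dh dy] : (y : words P) <= strip h.
  apply: (le_trans _ (strip_le eh)); rewrite ey.
  apply/le_wordsP; exists y; first exact: subseq_rcons.
  by elim: (y) => //= ? ? ->; rewrite lexx.
have [e' [eh' ge' ey']] := IH d dh.
exists (rcons e' (Some c)); rewrite ple_rcons eh' cb strip_rcons ey' dy cats1.
split=> //; apply: greedy_rcons => //.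
by have [] := pleP _ _ eh'.
Qed.

(** * Descending chains and their labels *)

Definition descends x (c : seq (words P)) : bool :=
  path (fun a b => covers b a) x c.

(** The leftmost choice makes a difference only in runs of a minimal letter. *)
Definition pos h z : nat :=
  find (fun i => strip (red h i) == z) (iota 0 (size h)).

(** The letter at [i] is minimal, about to be erased, and the letter before it
    could have been embedded at position [i] of [W] instead. *)
Definition slides W h i : bool :=
  [&& parent (h@i) == None, prev h i != None & prev h i <= W@i].

Definition label W h i : nat := (i.*2 + ~~ slides W h i)%N.

Fixpoint final h (c : seq (words P)) : seq Q :=
  if c is z :: c' then final (red h (pos h z)) c' else h.

Fixpoint labels W h (c : seq (words P)) : seq nat :=
  if c is z :: c' then label W h (pos h z) :: labels W (red h (pos h z)) c'
  else [::].

Lemma posP h z : covers z (strip h) ->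
  [/\ h@(pos h z) <> None, strip (red h (pos h z)) = z
    & forall j, (j < pos h z)%N -> strip (red h j) <> z].
Proof.
move=> zh; have [i hi zi] := covers_strip zh; have ih := ltn_nth hi.
have hs : has (fun i => strip (red h i) == z) (iota 0 (size h)).
  by apply/hasP; exists i; rewrite ?mem_iota ?zi.
have ph : (pos h z < size h)%N by move: hs; rewrite has_find size_iota.
have pz : strip (red h (pos h z)) = z.
  by apply/eqP; have := nth_find 0%N hs; rewrite -/(pos h z) nth_iota.
split=> // [h0|j jp].
  case/coversP: zh => + _; rewrite -pz lt_neqAle => /andP[/negP+ _]; apply.
  apply/eqP; congr strip; apply: (@eq_from_nth _ None); rewrite ?size_red // => k _.
  by rewrite nth_red h0 parent0; case: eqP => [->|].
apply/eqP; have := before_find 0%N jp.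
by rewrite nth_iota ?(ltn_trans jp) // => ->.
Qed.

Lemma pos_eq h i : h@i <> None ->
  (forall j, (j < i)%N -> h@j <> None -> strip (red h j) <> strip (red h i)) ->
  pos h (strip (red h i)) = i.
Proof.
move=> hi first; have [hp eqp minp] := posP (covers_red hi).
have [lt|lt|//] := ltngtP (pos h (strip (red h i))) i.
- by case: (first _ lt hp).
- by case: (minp _ lt).
Qed.

Lemma descends_cons h z c : descends (strip h) (z :: c) ->
  [/\ h@(pos h z) <> None, strip (red h (pos h z)) = z,
      forall j, (j < pos h z)%N -> strip (red h j) <> z
    & descends (strip (red h (pos h z))) c].
Proof. by move=> /= /andP[/posP[? eqz ?] zc]; split; rewrite ?eqz. Qed.

Lemma final_ple h c : descends (strip h) c -> final h c <<= h.
Proof.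
elim: c h => [|z c IH] h; first by rewrite ple_refl.
move=> /descends_cons[h0 _ _ /IH/ple_trans]; apply.
by rewrite red_ple ?ltn_nth.
Qed.

Lemma strip_final h c : descends (strip h) c -> strip (final h c) = last (strip h) c.
Proof.
by elim: c h => [|z c IH] h // /descends_cons[_ eqz _ /IH]; rewrite eqz.
Qed.

Lemma size_final h c : descends (strip h) c -> size (final h c) = size h.
Proof. by move=> /final_ple/pleP[]. Qed.

Lemma label_ge W h i : (i.*2 <= label W h i)%N.
Proof. exact: leq_addr. Qed.

Lemma label_le W h i : (label W h i <= i.*2.+1)%N.
Proof. by rewrite /label; case: slides => /=; lia. Qed.

Lemma label_ltn W h h' i j : (i < j)%N -> (label W h i < label W h' j)%N.
Proof. by move=> ij; have := label_le W h i; have := label_ge W h' j; lia. Qed.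

(** A step at position [j] has a label at most [j.*2.+1], so labels from [i.*2] on
    belong to the positions from [i] on. *)
Lemma final_agree W h c i : descends (strip h) c ->
  all (fun l => i.*2 <= l)%N (labels W h c) ->
  forall j, (j < i)%N -> (final h c)@j = h@j.
Proof.
elim: c h => [|z c IH] h // /descends_cons[_ _ _ zc] /= /andP[lp la] j ji.
rewrite IH //.
rewrite nth_red ifN //; have := label_le W h (pos h z); move: lp; set l := label _ _ _.
by move=> ??; apply/eqP; lia.
Qed.

Lemma prev_agree e h i : size e = size h -> (forall j, (j < i)%N -> e@j = h@j) ->
  prev e i = prev h i.
Proof.
move=> se agree; rewrite /prev; congr (last _ (map _ (strip _))).
apply: (@eq_from_nth _ None); rewrite ?size_take ?se // => k ki.
have ki' : (k < i)%N by move: ki; case: ifP; lia.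
by rewrite !nth_take // agree.
Qed.

Lemma prev_split e i p : prev e i = Some p ->
  exists a n, take i e = a ++ Some p :: nseq n None.
Proof.
rewrite /prev; elim/last_ind: (take i e) => // s [q|] IH; rewrite strip_rcons.
  by rewrite map_cat last_cat /= => -[->]; exists s, 0%N; rewrite cats1.
rewrite cats0 => /IH[a [n ->]]; exists a, n.+1.
by rewrite rcons_cat rcons_cons -cats1 -addn1 nseqD.
Qed.

Lemma strip_nseq n : strip (nseq n None) = [::].
Proof. by elim: n. Qed.

Lemma red_cat a q s : red (a ++ q :: s) (size a) = a ++ parent q :: s.
Proof.
by rewrite redE ?size_cat ?addnS ?ltnS ?leq_addr // take_size_cat // nth_cat ltnn
  subnn drop_cat ltnNge leqnSn /= subSnn /= drop0.
Qed.

(** Erasing the earlier of two equal letters separated only by gaps gives the same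
    word, so the leftmost position would have been another one. *)
Lemma pos_neq_prev h z : covers z (strip h) -> parent (h@(pos h z)) = None ->
  prev h (pos h z) <> h@(pos h z).
Proof.
move=> /posP[]; set i := pos h z; case hi: (h@i) => [p|//] _ eqz minp p0.
move=> /prev_split[a [n tk]]; have ih : (i < size h)%N by rewrite ltn_nth // hi.
have ai : (size a < i)%N.
  by rewrite -(size_takel (ltnW ih)) tk size_cat /= addnS ltnS leq_addr.
apply: (minp _ ai); rewrite -eqz (redE ih) hi p0 [X in red X _](splitE ih) hi tk.
rewrite -catA red_cat p0 -catA !strip_cat /strip /= !pmap_cat.
by rewrite -/(strip (nseq n None)) strip_nseq.
Qed.

(** The step that erases the letter at [i] would have the label [i.*2]: the letter
    before it stays the same, since no step occurs before position [i]. *)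
Lemma final_neq0 W h c i : h <<= W -> descends (strip h) c ->
  h@i <> None -> prev h i <> None -> prev h i <= W@i ->
  all (fun l => i.*2 < l)%N (labels W h c) -> (final h c)@i <> None.
Proof.
elim: c h => [|z c IH] h // hW /descends_cons[hp _ _ zc] hi pi piW /= /andP[lp la].
have pr : prev (red h (pos h z)) i = prev h i.
  apply: prev_agree; first by rewrite size_red ?ltn_nth.
  move=> j ji; rewrite nth_red ifN //; apply/eqP => jp.
  by have := leq_trans lp (label_le _ _ _); rewrite -jp; lia.
apply: IH => //; rewrite ?pr //.
  by apply: ple_trans hW; rewrite red_ple ?ltn_nth.
rewrite nth_red; case: eqP => // ip h0; move: h0 lp; rewrite /label -ip /slides => ->.
by rewrite eqxx piW andbT; case: eqP => //=; rewrite addn0 ltnn.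
Qed.

(** So the first step of an increasing chain occurs at the first position where
    its two end expansions differ. *)
Lemma increasing_head W h z c : descends (strip h) (z :: c) ->
  sorted leq (labels W h (z :: c)) ->
  [/\ all (fun l => label W h (pos h z) <= l)%N (labels W (red h (pos h z)) c),
      (final h (z :: c))@(pos h z) <> h@(pos h z)
    & forall j, (j < pos h z)%N -> (final h (z :: c))@j = h@j].
Proof.
move=> dc sl; have [hp _ _ zc] := descends_cons dc.
have al := order_path_min leq_trans sl; split=> //.
  have [_ /(_ (pos h z))] := pleP _ _ (final_ple zc); rewrite nth_red eqxx /=.
  by move=> le eq; have := le_lt_trans le (lt_parent forestP hp); rewrite eq ltxx.
apply: (final_agree dc); apply/andP; split; first exact: label_ge.
by apply: sub_all al => l; apply: leq_trans; apply: label_ge.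
Qed.

(** Only the gap at the position [p] of the first step needs care.  If the letter
    before it could slide to [p] in [h], but no more after the step, then it equals
    the letter of [h] at [p].  For a minimal letter this contradicts the leftmost
    choice of [p]; otherwise [p] is erased later on, under the smaller label. *)
Lemma increasing_greedy W h c : h <<= W -> descends (strip h) c ->
  sorted leq (labels W h c) -> greedy (final h c) h.
Proof.
elim: c h => [|z c IH] h hW dc sl.
  by move=> i /= -> pi; rewrite lex0; apply/eqP.
have [al _ agree] := increasing_head dc sl.
have [hp eqz minp zc] := descends_cons dc; set p := pos h z in hp eqz minp al agree zc *.
have h'h : red h p <<= h by rewrite red_ple ?ltn_nth.
have := IH _ (ple_trans h'h hW) zc (path_sorted sl).
rewrite -[final _ c]/(final h (z :: c)); set e := final h (z :: c) in agree *.
move=> ge i ei pi; have := ge i ei pi; rewrite nth_red.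
case: eqP => // ip; rewrite ip in ei pi *; apply: contra => ple.
have pe : prev h p = prev e p by rewrite (@prev_agree e h) // size_final.
have [p0|/eqP p0] := eqVneq (parent (h@p)) None.
  rewrite le_parent // lt_neqAle ple andbT; apply/eqP; rewrite -pe.
  by apply: pos_neq_prev p0; case/andP: dc.
case: (@final_neq0 W _ _ p (ple_trans h'h hW) zc) => //.
- by rewrite nth_red eqxx.
- rewrite (@prev_agree _ h) ?pe //; first by rewrite size_red ?ltn_nth.
  by move=> j jp; rewrite nth_red ltn_eqF.
- rewrite (@prev_agree _ h) ?pe //; first 1 last.
  + by rewrite size_red ?ltn_nth.
  + by move=> j jp; rewrite nth_red ltn_eqF.
  by apply: le_trans ple _; have [_ ->] := pleP _ _ hW.
- apply: sub_all al => l; apply: leq_trans; rewrite /label /slides.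
  by move/eqP/negbTE: p0 => -> /=; rewrite addn1.
Qed.

Lemma final_neq h z c : descends (strip h) (z :: c) -> final h (z :: c) <> h.
Proof.
move=> /descends_cons[h0 _ _ /final_ple/pleP[_ /(_ (pos h z))]].
rewrite nth_red eqxx => + eq; rewrite -[final _ c]/(final h (z :: c)) eq.
by move/le_lt_trans/(_ (lt_parent forestP h0)); rewrite ltxx.
Qed.

(** The end expansion is the rightmost embedding, and the first step of each chain
    is where it first differs from [h]. *)
Lemma increasing_uniq W h c c' : h <<= W ->
  descends (strip h) c -> descends (strip h) c' ->
  sorted leq (labels W h c) -> sorted leq (labels W h c') ->
  last (strip h) c = last (strip h) c' -> c = c'.
Proof.
move=> hW dc dc' sc sc' eql; have : final h c = final h c'.
  apply: (@greedy_uniq _ _ h); rewrite ?strip_final //; try exact: final_ple.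
    exact: increasing_greedy sc'.
  exact: increasing_greedy sc.
elim: c c' h hW dc dc' sc sc' {eql} => [|z c IH] [|z' c'] h hW dc dc' sc sc' //.
- by move=> /esym/(final_neq dc').
- by move=> /(final_neq dc).
move=> eqf; have [_ nz az] := increasing_head dc sc.
have [_ nz' az'] := increasing_head dc' sc'.
have eqp : pos h z = pos h z'.
  have [lt|lt|//] := ltngtP (pos h z) (pos h z').
  - by case: nz; rewrite eqf az'.
  - by case: nz'; rewrite -eqf az.
have [h0 eqz _ zc] := descends_cons dc; have [_ eqz' _ zc'] := descends_cons dc'.
rewrite -eqz -eqz' eqp; congr (_ :: _); rewrite -eqp in zc'.
apply: (IH _ (red h (pos h z))) => //.
- by apply: ple_trans hW; rewrite red_ple ?ltn_nth.
- exact: path_sorted sc.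
- by rewrite eqp; apply: path_sorted sc'.
- by rewrite {2}eqp.
Qed.

Lemma descends_word_rank x c : descends x c ->
  word_rank x = (size c + word_rank (last x c))%N.
Proof. by elim: c x => //= z c IH x /andP[/covers_word_rank-> /IH->]; rewrite addSn. Qed.

(** A chain that diverges with a smaller label changes a position before the
    first difference of [h] and the rightmost embedding. *)
Lemma increasing_first W h c c' : h <<= W ->
  descends (strip h) c -> descends (strip h) c' ->
  sorted leq (labels W h c) -> last (strip h) c = last (strip h) c' -> c' <> c ->
  (labels W h c : seqlexi nat) < labels W h c'.
Proof.
elim: c c' h => [|z c IH] [|z' c'] h hW dc dc' sc eql ne //.
  have := descends_word_rank dc; rewrite eql /= => /eqP.
  by rewrite -[X in X == _]add0n eqn_add2r.
have [h0 eqz _ zc] := descends_cons dc; have [h0' eqz' _ zc'] := descends_cons dc'.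
have [eqp|nep] := eqVneq (pos h z) (pos h z').
  rewrite /= -eqp eqhead_ltxiE; rewrite -eqp in zc'; apply: IH => //.
  - by apply: ple_trans hW; rewrite red_ple ?ltn_nth.
  - exact: path_sorted sc.
  - by rewrite {2}eqp eqz eqz'.
  - by move=> eqc; apply: ne; rewrite -eqz -eqz' eqp eqc.
suff lt : (pos h z < pos h z')%N.
  have := label_ltn W h h lt => llt.
  by rewrite /= neqhead_ltxiE ?ltEnat // ltn_eqF.
have [_ nz agree] := increasing_head dc sc.
rewrite ltn_neqAle nep /= leqNgt; apply/negP => lt.
(* The first letter changed by [c'] belongs to the prefix kept by the rightmost
   embedding. *)
have sf : strip (final h (z' :: c')) = strip (final h (z :: c)).
  by rewrite !strip_final // eql.
have eq := greedy_prefix (final_ple dc) (increasing_greedy hW dc sc)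
  (final_ple dc') sf agree lt.
have [_ /(_ (pos h z'))] := pleP _ _ (final_ple zc'); rewrite nth_red eqxx.
rewrite -[final _ c']/(final h (z' :: c')) eq => le.
by have := le_lt_trans le (lt_parent forestP h0'); rewrite ltxx.
Qed.

Section Existence.
Variables (u w : words P).
Local Notation W := (map Some w).
Hypothesis no_double : forall (v1 v2 : seq P) (p : P),
  u <= (v1 ++ p :: v2 : words P) -> (v1 ++ p :: p :: v2 : words P) <= w ->
  (rank (Some p : Q) < 3)%N.

Lemma greedy_mono e h h' : greedy e h -> h' <<= h -> greedy e h'.
Proof.
move=> ge /pleP[_ le] i ei pi; apply: contra (ge i ei pi) => /le_trans; exact.
Qed.

(** If a rank 2 letter of [h] is to be erased for [e], then the step that erases it
    gets the larger label.  Otherwise the preceding letter [p] would lie below [W]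
    but not below [h] at [i], hence above a letter of rank 2, and doubling [p] in
    [strip e] would give a word which is still below [w]. *)
Lemma rank2_not_slides e h i : e <<= h -> h <<= W -> greedy e h -> u <= strip e ->
  e@i = None -> parent (h@i) <> None -> parent (parent (h@i)) = None ->
  prev e i <> None -> ~~ (prev e i <= W@i).
Proof.
move=> eh hW ge ue ei h1 h2 pi; apply/negP => pW.
have [sW leW] := pleP _ _ hW; have := ge i ei pi.
have /orP[->//|hp _] := le_down_total forestP pW (leW i).
have hlt : h@i < prev e i.
  rewrite lt_neqAle hp andbT; apply/eqP => eqh; have := ge i ei pi.
  by rewrite eqh lexx.
have h0 : h@i <> None by move=> h0; apply: h1; rewrite h0 parent0.
have rk : (2 < rank (prev e i))%N.
  have := le_rank forestP hp => -[]; rewrite (rankS forestP h0) (rankS forestP h1) h2.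
  rewrite rank0 leq_eqVlt => /orP[/eqP->|//] /esym; rewrite eqxx => /eqP eqh.
  by rewrite eqh ltxx in hlt.
case pe: (prev e i) pi rk pW => [p|//] _ rk pW.
have [a [n tk]] := prev_split pe.
have ie : (i < size e)%N.
  by have [-> _] := pleP _ _ eh; apply: ltn_nth.
suff : (rank (Some p : Q) < 3)%N by rewrite ltnS leqNgt rk.
apply: (@no_double (strip a) (strip (drop i.+1 e))).
  move: ue; rewrite [X in strip X](splitE ie) ei tk -catA !strip_cat /strip /=.
  by rewrite -/(strip (nseq n None)) strip_nseq.
rewrite -[w]strip_map; apply: (le_trans _ (_ : strip (set_nth None e i (Some p)) <= _)).
  rewrite set_nthE ie tk -catA !strip_cat /strip /=.
  by rewrite -/(strip (nseq n None)) strip_nseq.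
apply: strip_le; apply/pleP; have [sW' leW'] := pleP _ _ (ple_trans eh hW).
rewrite size_set_nth (maxn_idPr ie); split=> // j.
by rewrite nth_set_nth /=; case: eqP => [->|].
Qed.

(** Lower [h] to [e] at the first position where they differ, and recurse.  The
    condition on [l] strengthens the induction, so that the label of the first step
    can be prepended. *)
Lemma increasing_exists e h : e <<= h -> h <<= W -> greedy e h -> u <= strip e ->
  exists c, [/\ descends (strip h) c, last (strip h) c = strip e
    & forall l, (forall i, e@i <> h@i -> (forall j, (j < i)%N -> e@j = h@j) ->
                   (l <= label W h i)%N) -> path leq l (labels W h c)].
Proof.
have [n] := ubnP (erank h); elim: n h => // n IH h hn eh hW ge ue.
have [->|/eqP neh] := eqVneq e h; first by exists [::].
have := ple_neq eh neh => -[i0 ni0].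
case: (@ex_minnP (fun i => e@i != h@i)) => [|i /eqP ni mini]; first by exists i0; apply/eqP.
have agree j : (j < i)%N -> e@j = h@j.
  by move=> ji; apply/eqP; apply: contraTT ji => /mini; rewrite -leqNgt.
have hi : h@i <> None.
  move=> h0; apply: ni; have [_ /(_ i)] := pleP _ _ eh.
  by rewrite h0 lex0 => /eqP.
have eh' := ple_red eh ni; have h'h := red_ple (ltn_nth hi).
have h'W := ple_trans h'h hW; have ge' := greedy_mono ge h'h.
(* Lowering another position [j < i] would destroy the prefix of [h] kept by [e]. *)
have pz : pos h (strip (red h i)) = i.
  apply: pos_eq => // j ji hj eqj.
  have /le_words_strip[d dh de] : strip e <= strip (red h j) by rewrite eqj strip_le.
  have h''h := red_ple (ltn_nth hj).
  have eq := greedy_prefix eh ge (ple_trans dh h''h) de agree ji.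
  have [_ /(_ j)] := pleP _ _ dh; rewrite nth_red eqxx eq => le.
  by have := le_lt_trans le (lt_parent forestP hj); rewrite ltxx.
have [|c [dc lc sc]] := IH (red h i) _ eh' h'W ge' ue.
  by move: hn; rewrite (erank_red hi).
exists (strip (red h i) :: c); split=> //=; first by rewrite dc covers_red.
move=> l ll; rewrite pz ll //=; apply: sc => j nj agree'.
have [ji|ij|eqj] := ltngtP j i; last 1 first.
- rewrite eqj in nj agree' *; move: nj; rewrite nth_red eqxx => nj.
  have p0 : parent (h@i) <> None.
    move=> p0; apply: nj; have [_ /(_ i)] := pleP _ _ eh'.
    by rewrite nth_red eqxx p0 lex0 => /eqP.
  rewrite /label leq_add2l /slides nth_red eqxx; move/eqP/negbTE: (p0) => -> /=.
  case: eqP => //= p1; case: eqP => //= prv.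
  have pe : prev e i = prev (red h i) i.
    by apply: prev_agree => //; have [] := pleP _ _ eh'.
  rewrite -pe in prv *; rewrite lt0b; apply: (rank2_not_slides eh hW ge ue _ p0 p1 prv).
  suff : e@i <= parent (parent (h@i)) by rewrite p1 lex0 => /eqP.
  apply: le_parent; rewrite lt_neqAle.
  by have [_ /(_ i)] := pleP _ _ eh'; rewrite nth_red eqxx => ->; rewrite andbT; apply/eqP.
- by case: nj; rewrite nth_red ltn_eqF // agree.
- by apply: ltnW; apply: label_ltn.
Qed.

End Existence.

End Expansions.

(** * A disconnected interval *)

Section Doubling.
Context {disp : Order.disp_t} {P : porderType disp}.
Implicit Types (x y z : words P) (p : P).

Lemma le_words_size x y : x <= y -> (size x <= size y)%N.
Proof.
move=> /le_wordsP[s sy]; rewrite all2E => /andP[/eqP-> _]; exact: size_subseq.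
Qed.

Lemma all2_nth p (x y : seq P) :
  all2 <=%O x y <-> size x = size y /\ forall k, nth p x k <= nth p y k.
Proof.
split.
  elim: x y => [|a x IH] [|b y] //=.
  by move=> /andP[ab /IH[-> le]]; split=> // -[|k] /=.
elim: x y => [|a x IH] [|b y] [] //= /eq_add_S sxy le; rewrite (le 0%N) IH //.
by split=> // k; apply: (le k.+1).
Qed.

Lemma le_words_nth p x y : size x = size y ->
  x <= y <-> forall k, nth p x k <= nth p y k.
Proof.
move=> sxy; split=> [/le_wordsP[s sy xs] k|le].
  have [ss le] := (all2_nth p x s).1 xs.
  suff -> : y = s by [].
  by apply/eqP; rewrite eq_sym -(size_subseq_leqif sy).2 -ss sxy.
by apply/le_wordsP; exists y => //; apply/(all2_nth p).
Qed.

Lemma subseq_skip p (s t : seq P) : subseq s t -> size t = (size s).+1 ->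
  exists2 i, (i <= size s)%N & forall k, nth p s k = nth p t (bump i k).
Proof.
elim: t s => // b t IH [|a s] /=.
  by case: t {IH} => // _ _; exists 0%N => // k; rewrite nth_nil /bump add1n /= nth_nil.
case: eqP => [->|_] st /eq_add_S sz.
  have [i ile eqi] := IH _ st sz; exists i.+1 => // -[|k] //=.
  by rewrite bumpS eqi.
exists 0%N => // k; rewrite /bump add1n /=.
suff -> : t = a :: s by [].
by apply/eqP; rewrite eq_sym -(size_subseq_leqif st).2 sz.
Qed.

Definition le_skip p i x y : Prop := forall k, nth p x k <= nth p y (bump i k).

Lemma le_words_skip p x y : size y = (size x).+1 -> x <= y ->
  exists2 i, (i <= size x)%N & le_skip p i x y.
Proof.
move=> sz /le_wordsP[s sy xs]; have [ss le] := (all2_nth p x s).1 xs.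
have [|i ile eqi] := subseq_skip p sy; first by rewrite -ss.
by exists i => [|k]; rewrite ?ss // (le_trans (le k)) ?eqi.
Qed.

(** A word [z] strictly between the two has the length of one of them, and either
    [v1 p v2] embeds in [z] or [z] embeds in [v1 p p v2] by skipping one position.
    Skipping a position up to the first [p] and skipping a later one cannot both be
    possible, for then [z] would be an end of the interval; and comparable words
    can skip a common position.  So the skipped position separates the interval
    into two parts. *)
Lemma disconnected_double (v1 v2 : seq P) p p' : p' < p ->
  disconnected (v1 ++ p :: v2 : words P) (v1 ++ p :: p :: v2 : words P).
Proof.
set u : words P := v1 ++ p :: v2; set w : words P := v1 ++ [:: p, p & v2] => p'p.
set m := size v1.
have sw : size w = (size u).+1 by rewrite /u /w !size_cat /= !addnS.
have uw_low k : (k <= m)%N -> nth p u k = nth p w k.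
  rewrite /u /w !nth_cat -/m => km; case: ltngtP km => // -> _.
  by rewrite subnn.
have uw_high k : (m <= k)%N -> nth p u k = nth p w k.+1.
  rewrite /u /w !nth_cat -/m => mk; rewrite !ifN -?leqNgt ?(leqW mk) //.
  by rewrite subSn.
pose cls z i := (size z = size w /\ le_skip p i u z) \/
                (size z = size u /\ le_skip p i z w).
have sizes z : u < z < w -> size z = size w \/ size z = size u.
  move=> /andP[/ltW/le_words_size + /ltW/le_words_size]; rewrite sw.
  by lia.
have cls_ex z : u < z < w -> exists i, cls z i.
  move=> /[dup] /sizes[sz|sz] /andP[/ltW uz /ltW zw].
    by have [||i _ h] := @le_words_skip p u z; [rewrite sz|exact: uz|exists i; left].
  by have [||i _ h] := @le_words_skip p z w; [rewrite sz|exact: zw|exists i; right].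
have cls_sep z i j : u < z < w -> cls z i -> cls z j -> (i <= m < j)%N -> False.
  move=> /andP[uz zw] ci cj /andP[im mj].
  case: ci cj => -[sz hi] [] [sz' hj]; [|lia|lia|].
    have /(le_words_nth p (esym sz)) : forall k, nth p w k <= nth p z k.
      move=> k; have [km|mk] := leqP k m.
        by rewrite -uw_low //; have := hj k; rewrite /bump leqNgt (leq_ltn_trans km mj).
      case: k mk => // k mk; rewrite -uw_high //.
      by have := hi k; rewrite /bump (leq_trans im mk) add1n.
    by move/le_lt_trans/(_ zw); rewrite ltxx.
  have /(le_words_nth p sz) : forall k, nth p z k <= nth p u k.
    move=> k; have [km|mk] := leqP k m.
      rewrite uw_low //; have := hj k; rewrite /bump leqNgt (leq_ltn_trans km mj).
      by [].
    rewrite uw_high ?(ltnW mk) //; have := hi k.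
    by rewrite /bump (leq_trans im (ltnW mk)) add1n.
  by move/le_lt_trans/(_ uz); rewrite ltxx.
have cls_le z z' : u < z < w -> u < z' < w -> z <= z' -> exists i, cls z i /\ cls z' i.
  move=> zi zi' zz'; have [sz|sz] := sizes _ zi; have [sz'|sz'] := sizes _ zi'.
  - have [i [[_ ci]|[]]] := cls_ex _ zi; last lia.
    exists i; split; left; split=> // k; apply: le_trans (ci k) _.
    by apply: (le_words_nth p _).1 zz' _; rewrite sz sz'.
  - by have := le_words_size zz'; lia.
  - have [||i _ ci] := @le_words_skip p z z'; [by rewrite sz sz'|exact: zz'|].
    exists i; split; [right|left]; split=> // k; last apply: le_trans (ci k).
      apply: le_trans (ci k) _; apply: (le_words_nth p _).1 => //.
      by case/andP: zi' => _ /ltW.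
    apply: (le_words_nth p _).1; first by rewrite sz.
    by case/andP: zi => /ltW.
  - have [i [[]|[_ ci]]] := cls_ex _ zi'; first lia.
    exists i; split; right; split=> // k; apply: le_trans (ci k).
    by apply: (le_words_nth p _).1 zz' _; rewrite sz sz'.
have le_pp' : p' <= p := ltW p'p.
exists [set z | u < z < w /\ exists2 i, (i <= m)%N & cls z i]%classic.
exists [set z | u < z < w /\ exists2 i, (m < i)%N & cls z i]%classic.
split.
(* The components contain the words with one copy of [p] lowered to [p']. *)
- exists (v1 ++ p' :: p :: v2); split; last first.
    exists m => //; left; split; first by rewrite /w !size_cat.
    move=> k; rewrite /bump !nth_cat -/m; case: (leqP m k) => mk.
      by rewrite add1n subSn // ltnNge leqW.
    by rewrite add0n mk.
  apply/andP; split; rewrite lt_neqAle; apply/andP; split.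
  + by apply/eqP => /(congr1 size); rewrite /u !size_cat /=; lia.
  + apply/le_wordsP; exists u; last by apply/(all2_nth p).
    by apply: cat_subseq => //; apply: subseq_cons.
  + apply/eqP => /eqP; rewrite eqseq_cat // eqxx /= eqseq_cons => /andP[/eqP eqp _].
    by rewrite eqp ltxx in p'p.
  + apply/(le_words_nth p); first by rewrite /w !size_cat.
    by move=> k; rewrite !nth_cat; case: ifP => // _; case: (_ - _)%N.
- exists (v1 ++ p :: p' :: v2); split; last first.
    exists m.+1 => //; left; split; first by rewrite /w !size_cat.
    move=> k; rewrite /bump !nth_cat -/m; case: (leqP m.+1 k) => mk.
      by rewrite add1n !ifN -?leqNgt ?leqW ?(ltnW mk) // subSn ?(ltnW mk) //;
        rewrite -(subnSK mk).
    rewrite add0n; case: ltnP => // km.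
    by have -> : k = m by [lia]; rewrite subnn.
  apply/andP; split; rewrite lt_neqAle; apply/andP; split.
  + by apply/eqP => /(congr1 size); rewrite /u !size_cat /=; lia.
  + apply/le_wordsP; exists u; last by apply/(all2_nth p).
    by apply: cat_subseq => //=; rewrite eqxx; apply: subseq_cons.
  + apply/eqP => /eqP; rewrite eqseq_cat // eqxx /= !eqseq_cons => /and3P[_ /eqP eqp _].
    by rewrite eqp ltxx in p'p.
  + apply/(le_words_nth p); first by rewrite /w !size_cat.
    by move=> k; rewrite !nth_cat; case: ifP => // _; case: (_ - _)%N => [|[|]].
- apply/seteqP; split=> // z [[zi [i im ci]] [_ [j mj cj]]].
  by apply: cls_sep zi ci cj _; rewrite im.
- apply/seteqP; split=> z; first by case=> -[].
  move=> zi; have [i ci] := cls_ex z zi.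
  by have [im|mi] := leqP i m; [left|right]; split=> //; exists i.
- move=> a b [ai [i im ci]] [bi [j mj cj]]; rewrite /Order.comparable.
  apply/negP => /orP[ab|ba].
    have [k [ka kb]] := cls_le _ _ ai bi ab; have [km|mk] := leqP k m.
      by apply: cls_sep bi kb cj _; rewrite km.
    by apply: cls_sep ai ci ka _; rewrite im.
  have [k [kb ka]] := cls_le _ _ bi ai ba; have [km|mk] := leqP k m.
    by apply: cls_sep bi kb cj _; rewrite km.
  by apply: cls_sep ai ci ka _; rewrite im.
Qed.

End Doubling.

(** * Dual CL-shellability *)

Lemma covers_dual (disp : Order.disp_t) (T : porderType disp) (x y : T) :
  @covers _ (T^d)%type x y = covers y x.
Proof.
apply/asboolP/asboolP => -[yx nb]; split=> // z; have := nb z.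
  by rewrite andbC.
by rewrite andbC.
Qed.

Section Labeling.
Context {disp : Order.disp_t} {P : porderType disp}.
Hypothesis forestP : rooted_forest P.
Variable w : words P.
Local Notation W := (map Some w : seq (adjoin_bottom P)).
Implicit Types (m r t c : seq (words P)).

(** Labels depend on the part of the chain above the step through the expansion
    reached there. *)
Definition position_label m i : nat :=
  let h := final forestP W (take i m) in
  label forestP W h (pos forestP h (nth [::] m i)).

Lemma maximal_chain_dual (x y : words P) c :
  @maximal_chain _ (words P)^d%type x y c <-> descends x c /\ last x c = y.
Proof.
rewrite /maximal_chain /descends /=.
rewrite (@eq_path _ _ (fun a b => @covers _ (words P) b a)); last first.
  by move=> a b; apply: covers_dual.
exact: iff_refl.
Qed.

Lemma final_cat h r c :
  final forestP h (r ++ c) = final forestP (final forestP h r) c.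
Proof. by elim: r h => //= z r IH h. Qed.

Lemma label_seqE r t c :
  @label_seq _ (words P)^d%type _ nat position_label r t c
    = labels forestP W (final forestP W r) c.
Proof.
rewrite /label_seq; elim: c r => //= z c IH r.
have -> : red forestP (final forestP W r) (pos forestP (final forestP W r) z)
  = final forestP W (rcons r z) by rewrite -cats1 final_cat.
rewrite -IH size_rcons cat_rcons; congr (_ :: _).
by rewrite /position_label take_size_cat // nth_cat ltnn subnn.
Qed.

End Labeling.

Theorem theorem7p5 (disp : Order.disp_t) (P : porderType disp)
  (forestP : rooted_forest P) (u w : words P) (le_uw : u <= w)
  (no_disc : forall u' w' : words P,
     u <= u' -> u' <= w' -> w' <= w -> disconnected u' w' ->
     ~ (3 <= word_rank w' - word_rank u')%N) :
  dual_CL_shellable u w.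
Proof.
have no_double (v1 v2 : seq P) (p : P) : u <= (v1 ++ p :: v2 : words P) ->
    (v1 ++ p :: p :: v2 : words P) <= w -> (rank (Some p : adjoin_bottom P) < 3)%N.
  move=> uv vw; rewrite ltnNge; apply/negP => rp.
  have p0 : (Some p : adjoin_bottom P) <> None by [].
  case pp: (parent forestP (Some p)) (lt_parent forestP p0) (rankS forestP p0)
    => [p'|] p'p rk; last by move: rp; rewrite rk rank0.
  have {}p'p : p' < p by rewrite lt_leAnge; exact: p'p.
  apply: (no_disc _ _ uv _ vw (disconnected_double v1 v2 p'p)).
    apply/le_wordsP; exists (v1 ++ p :: v2); last by apply/(all2_nth p).
    by apply: cat_subseq => //; apply: subseq_cons.
  suff -> : word_rank (v1 ++ [:: p, p & v2] : words P)
    = (rank (Some p : adjoin_bottom P) + word_rank (v1 ++ p :: v2 : words P))%N.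
    by rewrite addnK.
  by rewrite /word_rank !big_cat /= !big_cons; lia.
split.
  split=> //.
    by apply: sub_finite_set (finite_below forestP w) => x /andP[].
  move=> m m' /maximal_chain_dual[dm lm] /maximal_chain_dual[dm' lm'].
  have := descends_word_rank forestP dm; rewrite (descends_word_rank forestP dm').
  by rewrite lm lm' => /addIn.
exists _, nat, (position_label forestP w); split.
  move=> m m' k _ _ km km' tk i ik; rewrite /position_label.
  have ti : take i m = take i m'.
    by rewrite -(take_takel m (ltnW ik)) tk take_takel // ltnW.
  by rewrite -(nth_take [::] ik m) tk nth_take // ti.
move=> x y r t xy /maximal_chain_dual[dr lr] /maximal_chain_dual[dt lt].
set W : seq (adjoin_bottom P) := map Some w; set h := final forestP W r.
have dr' : descends (strip W) r by rewrite strip_map.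
have hW : all2 <=%O h W := final_ple forestP dr'.
have hx : strip h = x by rewrite strip_final // strip_map.
have uy : u <= y.
  elim: t y dt lt {xy} => [|z t IH] y /=; first by move=> _ ->.
  by move=> /andP[/coversP[/ltW zy _] dt] lt; apply: le_trans (IH _ dt lt) zy.
have [d dh dy] : exists2 d, all2 <=%O d h & strip d = y.
  by apply/le_words_strip; rewrite hx; apply: xy.
have [e [eh ge ey]] := greedy_exists dh.
have [|c [dc lc sc]] := increasing_exists forestP no_double eh hW ge; first by rewrite ey dy.
have {}sc : sorted leq (labels forestP W h c).
  by apply: (@path_sorted _ leq 0%N); apply: sc.
rewrite -hx; exists c; split.
- by apply/maximal_chain_dual; rewrite lc ey.
- by rewrite label_seqE.
- move=> c' /maximal_chain_dual[dc' lc']; rewrite label_seqE => sc'.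
  by apply: (increasing_uniq hW dc' dc); rewrite ?lc' ?lc ?ey.
- move=> c' /maximal_chain_dual[dc' lc'] ne; rewrite !label_seqE.
  by apply: (increasing_first hW dc dc'); rewrite ?lc' ?lc ?ey.
Qed.
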